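(* Let $M$ be an abelian group and let $B_1 \subseteq B_2 \subseteq M$ be structuring elements. Then: (a) $O_{B_1}(g)^{-1}(0) \subseteq O_{B_2}(g)^{-1}(0)$ for every $g \in \mathcal{I}_M$ if and only if $B_1 \subseteq_{S,M} B_2$; (b) $C_{B_2}(g)^{-1}(0) \subseteq C_{B_1}(g)^{-1}(0)$ for every $g \in \mathcal{I}_M$ if and only if $B_1 \subseteq_{S,M} B_2$.
   Context: An image on $M$ is a function $g : M \to \mathbb{R}_{\geq 0}$; $\mathcal{I}_M$ is the set of all images on $M$. A structuring element is a finite set $B$ with $0 \in B \subseteq M$. With pixel set $M$: erosion $\epsilon_B(g)(x) = \min\{ g(x+b) : b \in B\}$, dilation $\delta_B(g)(x) = \max\{g(x-b) : b \in B\}$, opening $O_B = \delta_B \circ \epsilon_B$, closing $C_B = \epsilon_B \circ \delta_B$. For an image $h$, $h^{-1}(0) = \{x \in M : h(x) = 0\}$. $B_1 \subseteq_{S,M} B_2$ means: $B_1 \subseteq B_2$ and for every $b_2 \in B_2$ there exists $b_1 \in B_1$ with $B_1 + (b_2 - b_1) \subseteq B_2$, where $A + v = \{a + v : a \in A\}$. *)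

(* Defs.v *)
From HB Require Import structures.
From mathcomp Require Import all_boot all_order all_algebra finmap.
From mathcomp Require Import classical_sets reals interval_inference.

Set Implicit Arguments.
Unset Strict Implicit.
Unset Printing Implicit Defensive.

Import Order.TTheory GRing.Theory Num.Theory.
Local Open Scope ring_scope.

Definition gray_image (R : realType) (M : zmodType) : Type := M -> {nonneg R}.

Record structElem (M : zmodType) : Type := StructElem {
  se_fset :> {fset M};
  se_has0 : 0 \in se_fset
}.

(* The default value of each iterated min / max is the term for b = 0, which
   occurs anyway since 0 \in B; it therefore does not affect the value
   (see [erosionP] and [dilationP]). *)
Definition erosion (R : realType) (M : zmodType) (B : structElem M)
    (g : gray_image R M) : gray_image R M :=
  fun x => \big[Order.min/g (x + 0)]_(b <- B) g (x + b).

Definition dilation (R : realType) (M : zmodType) (B : structElem M)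
    (g : gray_image R M) : gray_image R M :=
  fun x => \big[Order.max/g (x - 0)]_(b <- B) g (x - b).

Definition opening (R : realType) (M : zmodType) (B : structElem M)
    (g : gray_image R M) : gray_image R M := dilation B (erosion B g).

Definition closing (R : realType) (M : zmodType) (B : structElem M)
    (g : gray_image R M) : gray_image R M := erosion B (dilation B g).

Definition zeros (R : realType) (M : zmodType) (h : gray_image R M) : set M :=
  [set x | (h x)%:num = 0]%classic.

Definition translate (M : zmodType) (A : {fset M}) (v : M) : {fset M} :=
  [fset (a + v)%R | a in A]%fset.

Definition ssubset (M : zmodType) (B1 B2 : {fset M}) : Prop :=
  (B1 `<=` B2)%fset /\
  forall b2, b2 \in B2 ->
    exists2 b1, b1 \in B1 & (translate B1 (b2 - b1) `<=` B2)%fset.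

Lemma erosionP (R : realType) (M : zmodType) (B : structElem M)
    (g : gray_image R M) (x : M) :
  (exists2 b, b \in se_fset B & erosion B g x = g (x + b)) /\
  (forall b, b \in se_fset B -> erosion B g x <= g (x + b)).
Proof.
split; last by move=> b bB; apply: ge_bigmin_seq bB _.
rewrite /erosion big_seq.
apply: (big_ind (fun y => exists2 b, b \in se_fset B & y = g (x + b))).
- by exists 0 => //; apply: se_has0.
- by move=> y z [b bB ->] [c cB ->]; case: leP => _; [exists b|exists c].
- by move=> b bB; exists b.
Qed.

Lemma dilationP (R : realType) (M : zmodType) (B : structElem M)
    (g : gray_image R M) (x : M) :
  (exists2 b, b \in se_fset B & dilation B g x = g (x - b)) /\
  (forall b, b \in se_fset B -> g (x - b) <= dilation B g x).
Proof.
split; last by move=> b bB; apply: le_bigmax_seq bB _.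
rewrite /dilation big_seq.
apply: (big_ind (fun y => exists2 b, b \in se_fset B & y = g (x - b))).
- by exists 0 => //; apply: se_has0.
- by move=> y z [b bB ->] [c cB ->]; case: leP => _; [exists c|exists b].
- by move=> b bB; exists b.
Qed.

(* Main.v *)
(** An opening vanishes at x iff every translate of B containing x meets the
    zero set of g, and a closing vanishes at x iff some translate of the
    reflection of B containing x lies inside the zero set of g.  The strong
    inclusion says that every translate of B2 containing x contains a translate
    of B1 containing x, so it transports both properties.  Conversely, given b2
    in B2, test the hypotheses at the point 0 on the indicator of B2 - b2 for
    (a), and of the complement of b2 - B2 for (b). *)
Require Import Defs.
From mathcomp Require Import all_boot all_order all_algebra finmap.
From mathcomp Require Import classical_sets reals interval_inference.

Set Implicit Arguments.
Unset Strict Implicit.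
Unset Printing Implicit Defensive.

Import Order.TTheory GRing.Theory Num.Theory.
Local Open Scope ring_scope.

Lemma nonneg_le0 (R : realType) (u v : {nonneg R}) :
  u <= v -> v%:num = 0 -> u%:num = 0.
Proof.
move=> uv v0; apply/eqP; rewrite eq_le; apply/andP; split=> //.
by rewrite -v0 num_le.
Qed.

Section Zeros.
Variables (R : realType) (M : zmodType).
Implicit Types (g : gray_image R M) (B : structElem M) (x : M).

Lemma zeros_erosion B g x :
  zeros (erosion B g) x <-> exists2 b, b \in se_fset B & zeros g (x + b).
Proof.
have [[b bB eb] le_er] := erosionP B g x; rewrite /zeros /=; split.
  by rewrite eb => gb; exists b.
by case=> c cB; apply: nonneg_le0; apply: le_er.
Qed.

(** The maximum dominates every term and is one of them; since values are nonnegative, it is zero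
    exactly when all terms are. *)
Lemma zeros_dilation B g x :
  zeros (dilation B g) x <-> forall b, b \in se_fset B -> zeros g (x - b).
Proof.
have [[b bB eb] le_dil] := dilationP B g x; rewrite /zeros /=; split.
  by move=> d0 c cB; apply: nonneg_le0 d0; apply: le_dil.
by move=> g0; rewrite eb; apply: g0.
Qed.

Lemma zeros_opening B g x :
  zeros (opening B g) x <-> forall b, b \in se_fset B ->
    exists2 c, c \in se_fset B & zeros g (x - b + c).
Proof.
rewrite /opening zeros_dilation.
by split=> h b bB; apply/zeros_erosion; apply: h.
Qed.

Lemma zeros_closing B g x :
  zeros (closing B g) x <-> exists2 b, b \in se_fset B &
    forall c, c \in se_fset B -> zeros g (x + b - c).
Proof.
rewrite /closing zeros_erosion.
by split=> -[b bB h]; exists b => //; apply/zeros_dilation.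
Qed.

Definition indicator (P : pred M) : gray_image R M :=
  fun y => if P y then 1%:nng else 0%:nng.

Lemma zeros_indicator (P : pred M) x : zeros (indicator P) x <-> ~~ P x.
Proof.
rewrite /zeros /indicator /=; case: (P x) => /=; last by split.
by split=> // /eqP; rewrite oner_eq0.
Qed.

End Zeros.

Lemma translate_subP (M : zmodType) (A B : {fset M}) (v : M) :
  reflect (forall a, a \in A -> a + v \in B) (translate A v `<=` B)%fset.
Proof.
apply: (iffP (@fsubsetP M _ _)) => [h a aA|h _ /imfsetP[a /= aA ->]];
  last exact: h.
by apply: h; apply/imfsetP; exists a.
Qed.

Section StrongInclusion.
Variables (R : realType) (M : zmodType) (B1 B2 : structElem M).

Lemma ssubset_zeros_opening (g : gray_image R M) :
  ssubset B1 B2 -> (zeros (opening B1 g) `<=` zeros (opening B2 g))%classic.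
Proof.
move=> [_ S12] x /zeros_opening o1; apply/zeros_opening => b2.
move=> /S12[b1 /o1[c1 c1B g0] /translate_subP h].
(* Shifting [c1] by [b2 - b1] makes the translate of [B2] by [x - b2] reach the same zero
   [x - b1 + c1]. *)
exists (c1 + (b2 - b1)); first exact: h.
suff -> : x - b2 + (c1 + (b2 - b1)) = x - b1 + c1 by [].
by rewrite [c1 + _]addrC -!addrA addKr.
Qed.

Lemma ssubset_zeros_closing (g : gray_image R M) :
  ssubset B1 B2 -> (zeros (closing B2 g) `<=` zeros (closing B1 g))%classic.
Proof.
move=> [_ S12] x /zeros_closing[b2 /S12[b1 b1B /translate_subP h] g0].
apply/zeros_closing; exists b1 => // c1 /h /g0.
suff -> : x + b2 - (c1 + (b2 - b1)) = x + b1 - c1 by [].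
by rewrite [c1 + _]addrC !opprD opprK -!addrA addNKr.
Qed.

Lemma zeros_opening_ssubset : (B1 `<=` B2)%fset ->
  (forall g : gray_image R M,
    (zeros (opening B1 g) `<=` zeros (opening B2 g))%classic) ->
  ssubset B1 B2.
Proof.
move=> B12 sub; split=> // b2 b2B.
(* Finiteness of [B1] makes the existence of a suitable [b1] decidable; the negative case is
   refuted. *)
have [/hasP[b1 b1B tr]|/hasPn no] :=
  boolP (has (fun b1 => translate B1 (b2 - b1) `<=` B2)%fset B1).
  by exists b1.
pose g : gray_image R M := indicator R (fun y => y + b2 \in se_fset B2).
have /sub/zeros_opening/(_ _ b2B)[c cB] : zeros (opening B1 g) 0.
  (* As [c + (b2 - b1)] lies outside [B2], the point [c - b1] lies outside [B2 - b2], the support of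
     [g]. *)
  apply/zeros_opening => b1 /no /fsubsetPn[_ /imfsetP[c /= cB ->] ncB].
  exists c => //; apply/zeros_indicator.
  by rewrite sub0r addrAC addrC [- b1 + b2]addrC.
(* The zero found is [c - b2] with [c] in [B2], which lies in the support: a contradiction. *)
by move/zeros_indicator; rewrite sub0r addrAC addNr add0r cB.
Qed.

(** No case split is needed: the [b1] witnessing the zero of the closing by [B1] is the required
    one, since [b1 - c] in [b2 - B2] means [c + (b2 - b1)] in [B2]. *)
Lemma zeros_closing_ssubset : (B1 `<=` B2)%fset ->
  (forall g : gray_image R M,
    (zeros (closing B2 g) `<=` zeros (closing B1 g))%classic) ->
  ssubset B1 B2.
Proof.
move=> B12 sub; split=> // b2 b2B.
pose g : gray_image R M := indicator R (fun y => b2 - y \notin se_fset B2).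
have /sub/zeros_closing[b1 b1B g0] : zeros (closing B2 g) 0.
  apply/zeros_closing; exists b2 => // c cB; apply/zeros_indicator.
  by rewrite negbK add0r subKr.
exists b1 => //; apply/translate_subP => c /g0/zeros_indicator.
by rewrite negbK add0r opprB addrCA.
Qed.

End StrongInclusion.

Theorem theorem5 (R : realType) (M : zmodType) (B1 B2 : structElem M)
    (B12 : (B1 `<=` B2)%fset) :
  ((forall g : gray_image R M,
      (zeros (opening B1 g) `<=` zeros (opening B2 g))%classic) <->
     ssubset B1 B2) /\
  ((forall g : gray_image R M,
      (zeros (closing B2 g) `<=` zeros (closing B1 g))%classic) <->
     ssubset B1 B2).
Proof.
split; split.
- exact: zeros_opening_ssubset.
- by move=> S12 g; apply: ssubset_zeros_opening.
- exact: zeros_closing_ssubset.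
- by move=> S12 g; apply: ssubset_zeros_closing.
Qed.
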